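(* Let $K$ be a field of characteristic zero, and let $P_{2n}$ be the free metabelian Poisson algebra over $K$ of rank $2n$ generated by $x_1,\ldots,x_n,y_1,\ldots,y_n$. Let $\delta$ be the derivation of $P_{2n}$ with $\delta(y_i)=x_i$, $\delta(x_i)=0$ for $i=1,\ldots,n$. Write $z_i=x_i$ and $z_{n+i}=y_i$ for $1\le i\le n$, let \[ \mathcal{B}_3=\{[z_i,z_j]\cdot z_k \mid 1\le j\le i\le 2n,\ 1\le k\le 2n\}, \] and let $K\mathcal{B}_3$ be the $K$-linear span of $\mathcal{B}_3$ in $P_{2n}$. Then the $K$-vector space $(K\mathcal{B}_3)^{\delta}=\{p\in K\mathcal{B}_3 : \delta(p)=0\}$ has a basis consisting of the elements of the following forms, where the indices are taken in $\{1,\ldots,n\}$: \[ [x_i,x_j]\cdot x_k,\quad j<i, \] \[ [y_i,x_i]\cdot x_j,\quad i,j, \] \[ [x_i,x_j]\cdot y_k+[y_j,x_i]\cdot x_k,\quad j<i<k, \] \[ [y_i,x_j]\cdot x_k+[y_j,x_i]\cdot x_k,\quad j<i<k. \]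
   Context: A Poisson algebra over $K$ is a $K$-vector space $P$ with a commutative associative product $\cdot$ and a Lie bracket $[\ ,\ ]$ such that $[a,b\cdot c]=[a,b]\cdot c+[a,c]\cdot b$ for all $a,b,c\in P$. It is abelian if $a\cdot b=[a,b]=0$ for all $a,b\in P$, and metabelian if it is an extension of an abelian Poisson algebra by an abelian Poisson algebra. The free metabelian Poisson algebra $P_{2n}$ is the relatively free algebra of rank $2n$ in the class of metabelian Poisson algebras, with free generators $x_1,\ldots,x_n,y_1,\ldots,y_n$; the following identities hold in it: \[ 0=a\cdot b\cdot c\cdot d=[a\cdot b,c\cdot d]=[[a,b],c\cdot d]=[a,b]\cdot c\cdot d=[a,b]\cdot[c,d]=[[a,b],[c,d]]. \] A derivation of a Poisson algebra is a linear map satisfying the Leibniz rule for both $\cdot$ and $[\ ,\ ]$; the derivation $\delta$ is determined by its values on the generators.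
   Formalization: In the third and fourth families the condition j<i<k is replaced by j<i with k arbitrary in {1,…,n}; as printed the claim fails for every n≥2, since the constant [x_2,x_1]·y_1+[y_1,x_2]·x_1 is not in the span of the printed list. *)

(* Defs.v *)
From HB Require Import structures.
From mathcomp Require Import all_boot all_order all_algebra.

Set Implicit Arguments.
Unset Strict Implicit.
Unset Printing Implicit Defensive.

Import GRing.Theory.
Local Open Scope ring_scope.

(* The commutative product is not assumed to have a unit. *)
HB.mixin Record Lmodule_isPoisson (K : fieldType) P of GRing.Lmodule K P := {
  pmul : P -> P -> P;
  pbr : P -> P -> P;
  pmul_linearl : forall b, linear (pmul^~ b);
  pmulC : forall a b, pmul a b = pmul b a;
  pmulA : forall a b c, pmul a (pmul b c) = pmul (pmul a b) c;
  pbr_linearl : forall b, linear (pbr^~ b);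
  pbr_linearr : forall a, linear (pbr a);
  pbrxx : forall a, pbr a a = 0;
  pbr_jacobi : forall a b c,
    pbr (pbr a b) c + pbr (pbr b c) a + pbr (pbr c a) b = 0;
  pbr_leibniz : forall a b c,
    pbr a (pmul b c) = pmul (pbr a b) c + pmul (pbr a c) b
}.

#[short(type="poissonAlgType")]
HB.structure Definition PoissonAlg (K : fieldType) :=
  {P of Lmodule_isPoisson K P & GRing.Lmodule K P}.

Declare Scope poisson_scope.
Notation "a ** b" := (pmul a b) (at level 40, left associativity)
  : poisson_scope.
Notation "\[ a , b \]" := (pbr a b) (at level 0, a, b at level 99)
  : poisson_scope.
Local Open Scope poisson_scope.

Section Poisson.
Context {K : fieldType}.
Implicit Types P Q A B : poissonAlgType K.

Definition abelian_poisson P :=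
  forall a b : P, a ** b = 0 /\ \[ a, b \] = 0.

Definition poisson_hom P Q (f : P -> Q) :=
  [/\ linear f,
      forall a b, f (a ** b) = f a ** f b
    & forall a b, f \[ a, b \] = \[ f a, f b \]].

Definition poisson_extension A B P :=
  exists (f : A -> P) (g : P -> B),
    [/\ poisson_hom f /\ injective f,
        poisson_hom g /\ (forall b, exists p, g p = b)
      & forall p, g p = 0 <-> exists a, f a = p].

Definition metabelian P :=
  exists A B, [/\ abelian_poisson A, abelian_poisson B
                & poisson_extension A B P].

Definition free_metabelian (m : nat) P (z : 'I_m -> P) :=
  metabelian P /\
  forall Q, metabelian Q -> forall u : 'I_m -> Q,
    (exists f : P -> Q, poisson_hom f /\ forall i, f (z i) = u i) /\
    (forall f g : P -> Q, poisson_hom f -> poisson_hom g ->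
       (forall i, f (z i) = u i) -> (forall i, g (z i) = u i) -> f =1 g).

Definition poisson_derivation P (d : P -> P) :=
  [/\ linear d,
      forall a b, d (a ** b) = d a ** b + a ** d b
    & forall a b, d \[ a, b \] = \[ d a, b \] + \[ a, d b \]].

End Poisson.

Section LinearAlgebra.
Context {K : fieldType} {V : lmodType K}.
Implicit Types E U : V -> Prop.

Definition lin_span E (p : V) :=
  exists s : seq (K * V),
    (forall e, e \in s -> E e.2) /\ p = \sum_(e <- s) e.1 *: e.2.

Definition lin_indep E :=
  forall s : seq V, uniq s -> (forall e, e \in s -> E e) ->
  forall c : V -> K, \sum_(e <- s) c e *: e = 0 ->
  forall e, e \in s -> c e = 0.

Definition is_basis U E :=
  [/\ forall e, E e -> U e, lin_indep E & forall p, U p -> lin_span E p].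

End LinearAlgebra.

Section Constants.
Context {K : fieldType} {P : poissonAlgType K}.

Definition B3 (m : nat) (z : 'I_m -> P) (p : P) :=
  exists i j k : 'I_m, (j <= i)%N /\ p = \[ z i, z j \] ** z k.

Definition B3_constants (m : nat) (z : 'I_m -> P) (d : P -> P) (p : P) :=
  lin_span (B3 z) p /\ d p = 0.

(* The index k is unrestricted in the third and fourth families too: if it is
   restricted to k > i they no longer span the constants, for instance
   [x_2,x_1].y_1 + [y_1,x_2].x_1 is missed when n = 2. *)
Inductive B3_constants_elt (n : nat) (x y : 'I_n -> P) : P -> Prop :=
| Cxxx (i j k : 'I_n) of (j < i)%N :
    B3_constants_elt x y (\[ x i, x j \] ** x k)
| Cyxx_diag (i j : 'I_n) :
    B3_constants_elt x y (\[ y i, x i \] ** x j)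
| Cxxy (i j k : 'I_n) of (j < i)%N :
    B3_constants_elt x y (\[ x i, x j \] ** y k + \[ y j, x i \] ** x k)
| Cyxx (i j k : 'I_n) of (j < i)%N :
    B3_constants_elt x y (\[ y i, x j \] ** x k + \[ y j, x i \] ** x k).

End Constants.

(* Main.v *)
From HB Require Import structures.
Require Import Defs.
From mathcomp Require Import all_boot all_order all_algebra.
From mathcomp Require Import ring.

(** Write w(a,b,c) for [z_a,z_b].z_c, so that the w(a,b,c) span K B_3 and
    w(a,b,c) = - w(b,a,c). The only fact about P needed from freeness is that
    every linear relation between them follows from this antisymmetry. This is
    obtained by mapping P to a metabelian Poisson algebra of dimension 7, the
    witness below: it has three coordinates in degree one, which can be
    prescribed on the generators by arbitrary covectors u, v, t, and a
    coordinate in degree three whose value at [p,q].r is (u(p) v(q) - v(p)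
    u(q)) t(r). Taking Dirac covectors gives linear forms phi_abc on P that
    read off the coefficient of w(a,b,c), and the same formula evaluates
    phi_abc after delta: since delta sends y_i to x_i and x_i to 0, applying
    phi_abc to delta(p) amounts to applying to p the sum of the forms in which
    one index of type x_i has been replaced by y_i (transpose_delta,
    delta_YYX, delta_YXX, delta_XXY, delta_XXX).

    Independence (elt_indep). Each listed element e has one monomial w(a,b,c)
    which occurs in no other listed element, so phi_abc separates e from the
    rest. These monomials are [x_i,x_j].x_k, [y_i,x_i].x_k, [x_i,x_j].y_k and
    [y_i,x_j].x_k, with j < i except in the second one; the other term
    [y_j,x_i].x_k in the last two families has its indices in the opposite
    order.

    Spanning (constant_span). An element p of K B_3 satisfies 2 p = sum over
    all a, b, c of phi_abc(p) w(a,b,c). If delta(p) = 0, the resulting linear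
    relations force every coordinate with at least two indices of type y to
    vanish; characteristic different from 2 is used here, and again to divide
    the sum by 2. The relation from delta_XXX says that the coefficient c_ijk
    of [x_i,x_j].y_k is b_jik - b_ijk, where b_ijk is the coefficient of
    [y_i,x_j].x_k. Substituting this, 2 p becomes the sum over all i, j, k of
<<
      a_ijk [x_i,x_j].x_k + c_ijk ([x_i,x_j].y_k + [y_j,x_i].x_k)
                          + b_ijk ([y_i,x_j].x_k + [y_j,x_i].x_k),
>>
    where a_ijk is the coefficient of [x_i,x_j].x_k, and each of the three
    elements is a combination of the listed ones for all i, j and k, without
    the restriction j < i. *)

Set Implicit Arguments.
Unset Strict Implicit.
Unset Printing Implicit Defensive.

Import GRing.Theory.
Local Open Scope ring_scope.
Local Open Scope poisson_scope.

(** * Abelian Poisson algebras *)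

Definition null_poisson (K : fieldType) (V : lmodType K) : Type := V.

Section NullPoisson.
Context {K : fieldType} {V : lmodType K}.
Implicit Types a b c : null_poisson V.

HB.instance Definition _ := GRing.Lmodule.on (null_poisson V).

Definition null_op a b : null_poisson V := 0.

Fact null_op_linearl b : linear (null_op^~ b).
Proof. by move=> k a a'; rewrite /null_op scaler0 addr0. Qed.

Fact null_op_linearr a : linear (null_op a).
Proof. by move=> k b b'; rewrite /null_op scaler0 addr0. Qed.

Fact null_op_sum3 a b c :
  null_op (null_op a b) c + null_op (null_op b c) a + null_op (null_op c a) b
    = 0.
Proof. by rewrite /null_op !addr0. Qed.

Fact null_op_leibniz a b c :
  null_op a (null_op b c) = null_op (null_op a b) c + null_op (null_op a c) b.
Proof. by rewrite /null_op addr0. Qed.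

HB.instance Definition _ := Lmodule_isPoisson.Build K (null_poisson V)
  null_op_linearl (fun _ _ => erefl) (fun _ _ _ => erefl)
  null_op_linearl null_op_linearr (fun _ => erefl) null_op_sum3 null_op_leibniz.

Lemma null_poisson_abelian : abelian_poisson (null_poisson V).
Proof. by []. Qed.

End NullPoisson.

(** * A metabelian Poisson algebra of dimension seven *)

(** A quotient of the free metabelian algebra of rank three in which the
    degree three element [a,b].c, with value (a_1 b_2 - a_2 b_1) c_3, survives.
    The first triple holds the degree one coordinates a_1, a_2, a_3.  The last
    four hold, in order, the bracket a_1 b_2 - a_2 b_1, the symmetric products
    a_1 b_3 + a_3 b_1 and a_2 b_3 + a_3 b_2, and the value in degree three.
    The symmetric products are there because the Leibniz rule
    [a.b,c] = [a,c].b + [b,c].a has a right-hand side with nonzero value, which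
    must be a function of a.b and c. *)
Definition witness (K : fieldType) : Type :=
  ((K^o * K^o * K^o) * (K^o * K^o * K^o * K^o))%type.

Section Witness.
Context {K : fieldType}.
Implicit Types a b c : witness K.

HB.instance Definition _ := GRing.Lmodule.on (witness K).

Definition witness_mul a b : witness K :=
  let: ((a1, a2, a3), (al, _, _, _)) := a in
  let: ((b1, b2, b3), (bl, _, _, _)) := b in
  ((0, 0, 0),
   (0, a1 * b3 + a3 * b1, a2 * b3 + a3 * b2, al * b3 + bl * a3)).

(** The bracket of a symmetric product with an element of degree one is forced
    by the Leibniz rule; the bracket of a bracket with anything is zero. *)
Definition witness_br a b : witness K :=
  let: ((a1, a2, _), (_, as1, as2, _)) := a in
  let: ((b1, b2, _), (_, bs1, bs2, _)) := b in
  ((0, 0, 0),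
   (a1 * b2 - a2 * b1, 0, 0, (as1 * b2 - as2 * b1) - (bs1 * a2 - bs2 * a1))).

Fact scale_regularE (k : K) (u : K^o) : k *: u = k * u.
Proof. by []. Qed.

Ltac witness_ring :=
  repeat (move=> [[[? ?] ?] [[[? ?] ?] ?]]);
  rewrite /= ?/witness_mul ?/witness_br /=;
  repeat (congr (_, _)); rewrite /= ?scale_regularE; ring.

Fact witness_mul_linearl b : linear (witness_mul^~ b).
Proof. move=> k; move: b; witness_ring. Qed.

Fact witness_mulC a b : witness_mul a b = witness_mul b a.
Proof. move: a b; witness_ring. Qed.

Fact witness_mulA a b c :
  witness_mul a (witness_mul b c) = witness_mul (witness_mul a b) c.
Proof. move: a b c; witness_ring. Qed.

Fact witness_br_linearl b : linear (witness_br^~ b).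
Proof. move=> k; move: b; witness_ring. Qed.

Fact witness_br_linearr a : linear (witness_br a).
Proof. move=> k; move: a; witness_ring. Qed.

Fact witness_brxx a : witness_br a a = 0.
Proof. move: a; witness_ring. Qed.

Fact witness_jacobi a b c :
  witness_br (witness_br a b) c + witness_br (witness_br b c) a
    + witness_br (witness_br c a) b = 0.
Proof. move: a b c; witness_ring. Qed.

Fact witness_leibniz a b c :
  witness_br a (witness_mul b c) =
  witness_mul (witness_br a b) c + witness_mul (witness_br a c) b.
Proof. move: a b c; witness_ring. Qed.

HB.instance Definition _ := Lmodule_isPoisson.Build K (witness K)
  witness_mul_linearl witness_mulC witness_mulA
  witness_br_linearl witness_br_linearr witness_brxx
  witness_jacobi witness_leibniz.

(** The elements with zero degree one part form an ideal with zero operations: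
    two of them multiply into degree at least four. *)
Lemma witness_metabelian : metabelian (witness K).
Proof.
exists (null_poisson (K^o * K^o * K^o * K^o)%type).
exists (null_poisson (K^o * K^o * K^o)%type).
split; [exact: null_poisson_abelian | exact: null_poisson_abelian |].
exists (fun a : null_poisson _ => ((0, a) : witness K)).
exists (fun a : witness K => a.1 : null_poisson _).
split; first split.
- split.
  + by move=> k a b; congr (_, _); witness_ring.
  + by move=> [[[? ?] ?] ?] [[[? ?] ?] ?]; rewrite /pmul /=; witness_ring.
  + by move=> [[[? ?] ?] ?] [[[? ?] ?] ?]; rewrite /pbr /=; witness_ring.
- by move=> a b [].
- split; last by move=> b; exists (b, 0).
  split=> //.
  + by move=> [[[? ?] ?] [[[? ?] ?] ?]] [[[? ?] ?] [[[? ?] ?] ?]].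
  + by move=> [[[? ?] ?] [[[? ?] ?] ?]] [[[? ?] ?] [[[? ?] ?] ?]].
- move=> [u v]; split=> [/= -> | [a [<- _]] //].
  by exists v.
Qed.

End Witness.

(** * Linear spans and dual families *)

Section Span.
Context {K : fieldType} {V : lmodType K}.
Implicit Types (E : V -> Prop) (p q : V) (f g : V -> K).

Lemma lin_span_mem E e : E e -> lin_span E e.
Proof.
move=> Ee; exists [:: (1, e)]; split=> [u|]; first by rewrite inE => /eqP ->.
by rewrite big_seq1 scale1r.
Qed.

Lemma lin_span0 E : lin_span E 0.
Proof. by exists [::]; rewrite big_nil. Qed.

Lemma lin_spanP E k p q :
  lin_span E p -> lin_span E q -> lin_span E (k *: p + q).
Proof.
move=> [s [sE ->]] [t [tE ->]].
exists ([seq (k * e.1, e.2) | e <- s] ++ t); split.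
  by move=> e; rewrite mem_cat => /orP[/mapP[u /sE Eu ->] // | /tE].
rewrite big_cat big_map scaler_sumr; congr (_ + _).
by apply: eq_bigr => e _; rewrite scalerA.
Qed.

Lemma lin_spanZ E k p : lin_span E p -> lin_span E (k *: p).
Proof. by move=> Ep; rewrite -[_ *: _]addr0; apply/lin_spanP/lin_span0. Qed.

Lemma lin_spanD E p q : lin_span E p -> lin_span E q -> lin_span E (p + q).
Proof. by rewrite -{2}[p]scale1r; apply: lin_spanP. Qed.

Lemma lin_spanN E p : lin_span E p -> lin_span E (- p).
Proof. by rewrite -scaleN1r; apply: lin_spanZ. Qed.

Lemma lin_span_sum E (I : finType) (F : I -> V) :
  (forall i, lin_span E (F i)) -> lin_span E (\sum_i F i).
Proof.
by move=> EF; apply: big_ind => //; [apply: lin_span0 | apply: lin_spanD].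
Qed.

Lemma lin_span_ind E (Q : V -> Prop) :
    Q 0 -> (forall k e p, E e -> Q p -> Q (k *: e + p)) ->
  forall p, lin_span E p -> Q p.
Proof.
move=> Q0 QS p [s [sE ->]]; elim: s sE => [|[k e] s IHs] sE.
  by rewrite big_nil.
rewrite big_cons; apply: QS; first by apply: (sE (k, e)); rewrite mem_head.
by apply: IHs => u us; apply: sE; rewrite inE us orbT.
Qed.

Lemma scalar0 f : scalar f -> f 0 = 0.
Proof.
move=> flin; have := flin (-1) 0 0.
by rewrite scaler0 addr0 mulN1r addNr.
Qed.

Lemma eq_lin_span E f g : scalar f -> scalar g ->
  (forall e, E e -> f e = g e) -> forall p, lin_span E p -> f p = g p.
Proof.
move=> flin glin fgE p; elim/lin_span_ind: p / => [|k e p /fgE fe fp].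
  by rewrite !scalar0.
by rewrite flin glin fe fp.
Qed.

Lemma scalar_sum f (c : V -> K) (s : seq V) : scalar f ->
  f (\sum_(e <- s) c e *: e) = \sum_(e <- s) c e * f e.
Proof.
move=> flin; elim: s => [|e s IHs]; first by rewrite !big_nil scalar0.
by rewrite !big_cons flin IHs.
Qed.

Lemma lin_indep_dual E :
    (forall e, E e -> exists f,
       [/\ scalar f, f e = 1 & forall e', E e' -> e' != e -> f e' = 0]) ->
  lin_indep E.
Proof.
move=> dual s us sE c sum0 e es.
have [f [flin fe f0]] := dual e (sE e es).
have := scalar_sum c s flin; rewrite sum0 (bigD1_seq e) //= fe scalar0 // mulr1.
rewrite big_seq_cond big1 ?addr0 // => e' /andP[/sE Ee' ne].
by rewrite f0 ?mulr0.
Qed.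

End Span.

(** Two scalar functions of [p] that are equal on the generators of a span
    containing [p] are equal at [p]; the functions are abstracted from the two
    sides of the goal. *)
Ltac on_generators p :=
  match goal with
  | p_span : lin_span ?E p |- ?lhs = ?rhs =>
    let f := match eval pattern p in lhs with ?f _ => f end in
    let g := match eval pattern p in rhs with ?g _ => g end in
    apply: (@eq_lin_span _ _ E f g _ _ _ p p_span)
  end.

(** * Operations in a Poisson algebra *)

Section PoissonOps.
Context {K : fieldType} {P : poissonAlgType K}.
Implicit Types a b c : P.

Lemma pmulDl a b c : (a + b) ** c = a ** c + b ** c.
Proof. by rewrite -[a in LHS]scale1r pmul_linearl scale1r. Qed.

Lemma pbrDl a b c : \[ a + b, c \] = \[ a, c \] + \[ b, c \].
Proof. by rewrite -[a in LHS]scale1r pbr_linearl scale1r. Qed.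

Lemma pbrDr a b c : \[ a, b + c \] = \[ a, b \] + \[ a, c \].
Proof. by rewrite -[b in LHS]scale1r pbr_linearr scale1r. Qed.

Lemma pmul0l a : 0 ** a = 0.
Proof. by apply: (addrI (0 ** a)); rewrite -pmulDl !addr0. Qed.

Lemma pmul0r a : a ** 0 = 0.
Proof. by rewrite pmulC pmul0l. Qed.

Lemma pbr0l a : \[ 0, a \] = 0.
Proof. by apply: (addrI \[ 0, a \]); rewrite -pbrDl !addr0. Qed.

Lemma pbr0r a : \[ a, 0 \] = 0.
Proof. by apply: (addrI \[ a, 0 \]); rewrite -pbrDr !addr0. Qed.

Definition poisson_op0 := (pmul0l, pmul0r, pbr0l, pbr0r, @pbrxx K P).

Lemma pmulNl a b : (- a) ** b = - (a ** b).
Proof. by apply/eqP; rewrite -addr_eq0 -pmulDl addNr pmul0l. Qed.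

Lemma pbrN a b : \[ a, b \] = - \[ b, a \].
Proof.
apply/eqP; rewrite -addr_eq0; apply/eqP.
by have := pbrxx (a + b); rewrite pbrDl !pbrDr !pbrxx addr0 add0r.
Qed.

Lemma pbr_pmulN a b c : \[ a, b \] ** c = - (\[ b, a \] ** c).
Proof. by rewrite pbrN pmulNl. Qed.

Lemma derivation_pbr_pmul (d : P -> P) a b c : poisson_derivation d ->
  d (\[ a, b \] ** c) =
  \[ d a, b \] ** c + \[ a, d b \] ** c + \[ a, b \] ** d c.
Proof. by case=> _ dM dB; rewrite dM dB pmulDl. Qed.

End PoissonOps.

(** * Linear forms on a free metabelian Poisson algebra *)

Section Cubic.
Context {K : fieldType}.

Definition cubic (I : Type) (u v t : I -> K) (a b c : I) : K :=
  (u a * v b - v a * u b) * t c.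

Definition dirac (I : eqType) (i : I) (a : I) : K := (a == i)%:R.

(** The universal property maps z_a to the element of the witness with degree
    one coordinates u(a), v(a), t(a); the four forms are coordinates of that
    homomorphism.  The formula is stated for all p, q, r, and not only for
    generators, so that it also evaluates the images under a derivation. *)
Lemma cubic_form (m : nat) (P : poissonAlgType K) (z : 'I_m -> P) :
    free_metabelian z -> forall u v t : 'I_m -> K,
  exists phi alpha beta gamma : P -> K,
  [/\ scalar phi,
      [/\ scalar alpha, scalar beta & scalar gamma],
      [/\ alpha \o z =1 u, beta \o z =1 v & gamma \o z =1 t]
    & forall p q r, phi (\[ p, q \] ** r) = cubic alpha beta gamma p q r].
Proof.
move=> [_ /(_ _ (@witness_metabelian K)) Pfree] u v t.
pose g a : witness K := ((u a, v a, t a), 0).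
have [[f [[flin fmul fbr] fz]] _] := Pfree g.
exists (fun p => (f p).2.2), (fun p => (f p).1.1.1).
exists (fun p => (f p).1.1.2), (fun p => (f p).1.2).
split; [|split|split|] => //=.
- by move=> k p q; rewrite flin.
- by move=> k p q; rewrite flin.
- by move=> k p q; rewrite flin.
- by move=> k p q; rewrite flin.
- by move=> a /=; rewrite fz.
- by move=> a /=; rewrite fz.
- by move=> a /=; rewrite fz.
move=> p q r; rewrite fmul fbr /cubic.
move: (f p) (f q) (f r) => [[[? ?] ?] [[[? ?] ?] ?]].
move=> [[[? ?] ?] [[[? ?] ?] ?]] [[[? ?] ?] [[[? ?] ?] ?]].
rewrite /pmul /pbr /=; ring.
Qed.

End Cubic.

(** * Coordinates and the derivation *)

Section Constants.
Context {K : fieldType} {n : nat} {P : poissonAlgType K}.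
Variables (x y : 'I_n -> P) (z : 'I_(n + n) -> P) (delta : P -> P).

Notation X := (lshift n).
Notation Y := (@rshift n n).
Notation w a b c := (\[ z a, z b \] ** z c).
Notation E := (B3_constants_elt x y).

Hypothesis zx : forall i, z (X i) = x i.
Hypothesis zy : forall i, z (Y i) = y i.
Hypothesis Pfree : free_metabelian z.
Hypothesis delta_der : poisson_derivation delta.
Hypothesis delta_y : forall i, delta (y i) = x i.
Hypothesis delta_x : forall i, delta (x i) = 0.

Lemma delta_zY i : delta (z (Y i)) = z (X i).
Proof. by rewrite zy delta_y zx. Qed.

Lemma delta_zX i : delta (z (X i)) = 0.
Proof. by rewrite zx delta_x. Qed.

(** The transpose of delta, acting on linear forms through the vectors [u] of
    their values at the generators. *)
Definition transpose_delta (u : 'I_(n + n) -> K) (a : 'I_(n + n)) : K :=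
  if split a is inr i then u (X i) else 0.

Lemma transpose_deltaE (alpha : P -> K) u :
    scalar alpha -> alpha \o z =1 u ->
  forall a, alpha (delta (z a)) = transpose_delta u a.
Proof.
move=> alin az a; rewrite /transpose_delta; case: (split_ordP a) => i ->.
  by rewrite delta_zX scalar0.
by rewrite delta_zY -az.
Qed.

Lemma transpose_delta_diracX i : transpose_delta (dirac (X i)) =1 dirac (Y i).
Proof.
move=> a; rewrite /transpose_delta /dirac; case: (split_ordP a) => j ->.
  by rewrite eq_lrshift.
by rewrite eq_lshift eq_rshift.
Qed.

Lemma transpose_delta_diracY i : transpose_delta (dirac (Y i)) =1 fun=> 0.
Proof.
move=> a; rewrite /transpose_delta /dirac; case: (split_ordP a) => // j _.
by rewrite eq_lrshift.
Qed.

(** The last clause follows from the one before it by expanding delta (w a b c).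
    It is recorded because in this form it is uniform in a, b and c, with no
    distinction between indices of type x and of type y. *)
Definition coordinate (i j k : 'I_(n + n)) (f : P -> K) :=
  let u := dirac i in let v := dirac j in let t := dirac k in
  [/\ scalar f,
      forall a b c, f (w a b c) = cubic u v t a b c
    & forall a b c, f (delta (w a b c)) =
        cubic (transpose_delta u) v t a b c +
        cubic u (transpose_delta v) t a b c +
        cubic u v (transpose_delta t) a b c].

Definition coordinates
    (phi : 'I_(n + n) -> 'I_(n + n) -> 'I_(n + n) -> P -> K) :=
  forall i j k, coordinate i j k (phi i j k).

Lemma coordinates_exist : exists phi, coordinates phi.
Proof.
suff /fin_all_exists[phi phiP] :
    forall s, exists f, coordinate s.1.1 s.1.2 s.2 f.
  by exists (fun i j k => phi (i, j, k)) => i j k; apply: (phiP (i, j, k)).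
move=> [[i j] k] /=.
have [phi [al [be [ga [flin [alin blin glin] [az bz gz] phiE]]]]] :=
  cubic_form Pfree (dirac i) (dirac j) (dirac k).
exists phi; split=> // a b c.
  by rewrite phiE /cubic -!az -!bz -!gz.
have fD p q : phi (p + q) = phi p + phi q.
  by rewrite -[p in LHS]scale1r flin mul1r.
rewrite derivation_pbr_pmul // !fD !phiE /cubic.
rewrite !(transpose_deltaE alin az) !(transpose_deltaE blin bz).
rewrite !(transpose_deltaE glin gz) -![al (z _)]/((al \o z) _).
rewrite -![be (z _)]/((be \o z) _) -![ga (z _)]/((ga \o z) _) !az !bz !gz.
ring.
Qed.

Section Coordinates.
Variable phi : 'I_(n + n) -> 'I_(n + n) -> 'I_(n + n) -> P -> K.
Hypothesis phiP : coordinates phi.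

Lemma phi_lin i j k : scalar (phi i j k).
Proof. by have [] := phiP i j k. Qed.

Lemma phiD i j k p q : phi i j k (p + q) = phi i j k p + phi i j k q.
Proof. by rewrite -[p in LHS]scale1r phi_lin mul1r. Qed.

Lemma phiE i j k a b c :
  phi i j k (w a b c) = cubic (dirac i) (dirac j) (dirac k) a b c.
Proof. by have [] := phiP i j k. Qed.

Lemma phi_deltaE i j k a b c :
  let u := dirac i in let v := dirac j in let t := dirac k in
  phi i j k (delta (w a b c)) =
    cubic (transpose_delta u) v t a b c + cubic u (transpose_delta v) t a b c
    + cubic u v (transpose_delta t) a b c.
Proof. by have [] := phiP i j k. Qed.

Lemma phi_antisym i j k p : lin_span (B3 z) p -> phi i j k p = - phi j i k p.
Proof.
move=> p_span; on_generators p => [|l q r|e [a [b [c [_ ->]]]]].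
- exact: phi_lin.
- by rewrite phi_lin; ring.
- by rewrite !phiE /cubic; ring.
Qed.

Lemma sum3_dirac (F : 'I_(n + n) -> 'I_(n + n) -> 'I_(n + n) -> P) a b c :
  \sum_i \sum_j \sum_k
    (dirac i a * dirac j b * dirac k c : K) *: F i j k = F a b c.
Proof.
rewrite (bigD1 a) //= [X in _ + X]big1 ?addr0 => [|i ia]; last first.
  rewrite big1 // => j _; rewrite big1 // => k _.
  by rewrite /dirac eq_sym (negPf ia) !mul0r scale0r.
rewrite (bigD1 b) //= [X in _ + X]big1 ?addr0 => [|j jb]; last first.
  rewrite big1 // => k _.
  by rewrite /dirac (eq_sym b) (negPf jb) mulr0 mul0r scale0r.
rewrite (bigD1 c) //= [X in _ + X]big1 ?addr0 => [|k kc]; last first.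
  by rewrite /dirac (eq_sym c) (negPf kc) mulr0 scale0r.
by rewrite /dirac !eqxx !mulr1 scale1r.
Qed.

(** The factor 2 comes from letting the sum run over all indices: by
    antisymmetry each w(a,b,c) is reached from (a,b,c) and from (b,a,c). *)
Lemma coordinate_expansion p : lin_span (B3 z) p ->
  p *+ 2 = \sum_i \sum_j \sum_k phi i j k p *: w i j k.
Proof.
move: p; apply: lin_span_ind => [|l e p [a [b [c [_ ->]]]] pE].
  rewrite mul0rn big1 // => i _; rewrite big1 // => j _; rewrite big1 // => k _.
  by rewrite (scalar0 (phi_lin _ _ _)) scale0r.
have wE : w a b c *+ 2 = \sum_i \sum_j \sum_k phi i j k (w a b c) *: w i j k.
  rewrite mulr2n {2}pbr_pmulN.
  rewrite -[X in X - _ = _](sum3_dirac (fun i j k => w i j k) a b c).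
  rewrite -[X in _ - X = _](sum3_dirac (fun i j k => w i j k) b a c) -sumrB.
  apply: eq_bigr => i _; rewrite -sumrB; apply: eq_bigr => j _; rewrite -sumrB.
  apply: eq_bigr => k _; rewrite -scalerBl phiE; congr (_ *: _).
  rewrite /cubic; ring.
rewrite mulrnDl scalerMnr wE pE scaler_sumr -big_split.
apply: eq_bigr => i _; rewrite scaler_sumr -big_split.
apply: eq_bigr => j _; rewrite scaler_sumr -big_split.
by apply: eq_bigr => k _; rewrite phi_lin scalerDl scalerA.
Qed.

(** Each slot of type x on the left gives one term on the right, with that slot
    changed to y: this is where delta (y i) = x i enters. *)
Section DeltaCoordinates.
Variable p : P.
Hypothesis p_span : lin_span (B3 z) p.

Lemma scalar_delta f : scalar f -> scalar (f \o delta).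
Proof.
by have [dlin _ _] := delta_der; move=> flin l q r; rewrite /= dlin flin.
Qed.

Ltac delta_coordinate :=
  on_generators p => [|l q r|e [a [b [c [_ ->]]]]];
  [ exact: (scalar_delta (phi_lin _ _ _)) | rewrite !phi_lin; ring | ];
  rewrite /= !phiE phi_deltaE /cubic;
  rewrite !(transpose_delta_diracX, transpose_delta_diracY); ring.

Lemma delta_YYX i j k :
  (phi (Y i) (Y j) (X k) \o delta) p = phi (Y i) (Y j) (Y k) p.
Proof. delta_coordinate. Qed.

Lemma delta_YXX i j k : (phi (Y i) (X j) (X k) \o delta) p =
  phi (Y i) (Y j) (X k) p + phi (Y i) (X j) (Y k) p.
Proof. delta_coordinate. Qed.

Lemma delta_XXY i j k : (phi (X i) (X j) (Y k) \o delta) p =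
  phi (Y i) (X j) (Y k) p + phi (X i) (Y j) (Y k) p.
Proof. delta_coordinate. Qed.

Lemma delta_XXX i j k : (phi (X i) (X j) (X k) \o delta) p =
  phi (Y i) (X j) (X k) p + phi (X i) (Y j) (X k) p + phi (X i) (X j) (Y k) p.
Proof. delta_coordinate. Qed.

End DeltaCoordinates.

Lemma lin_span_B3 a b c : lin_span (B3 z) (w a b c).
Proof.
have mem (a' b' : 'I_(n + n)) : (b' <= a')%N -> lin_span (B3 z) (w a' b' c).
  by move=> ba; apply: lin_span_mem; exists a', b', c.
case: (leqP b a) => [|/ltnW] ab; first exact: mem.
by rewrite pbr_pmulN; apply/lin_spanN/mem.
Qed.

Lemma elt_constant e : E e -> B3_constants z delta e.
Proof.
have deltaD p q : delta (p + q) = delta p + delta q.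
  by have [dlin _ _] := delta_der; rewrite -[p in LHS]scale1r dlin scale1r.
have deltaE := derivation_pbr_pmul _ _ _ delta_der.
case=> [i j k _|i j|i j k _|i j k _]; rewrite -!(zx, zy); split.
- exact: lin_span_B3.
- by rewrite deltaE !delta_zX !poisson_op0 ?(addr0, add0r).
- exact: lin_span_B3.
- by rewrite deltaE !(delta_zX, delta_zY) !poisson_op0 ?(addr0, add0r).
- by apply: lin_spanD; apply: lin_span_B3.
- rewrite deltaD !deltaE !(delta_zX, delta_zY) !poisson_op0 ?(addr0, add0r).
  by rewrite [\[ z (X j), _ \]]pbrN pmulNl subrr.
- by apply: lin_spanD; apply: lin_span_B3.
- rewrite deltaD !deltaE !(delta_zX, delta_zY) !poisson_op0 ?(addr0, add0r).
  by rewrite [\[ z (X j), _ \]]pbrN pmulNl subrr.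
Qed.

(** * Independence of the listed constants *)

Ltac by_contradiction :=
  match goal with
  | ne : is_true (?e != ?e) |- _ => by rewrite eqxx in ne
  | lt : is_true (?i < ?i)%N |- _ => by rewrite ltnn in lt
  | lt : is_true (?i < ?j)%N, lt' : is_true (?j < ?i)%N |- _ =>
      by have := ltn_trans lt lt'; rewrite ltnn
  end.

(** Compares the index triples of a coordinate and of a listed element slot by
    slot.  If they agree, possibly after exchanging the first two, then the
    element is the one from which the coordinate was chosen, or the order
    conditions on the indices clash; otherwise the coordinate is zero. *)
Ltac phi_case :=
  rewrite /= ?phiD !phiE /cubic /dirac;
  rewrite !(eq_lshift, eq_rshift, eq_lrshift, eq_rlshift) ?eqxx;
  repeat (case: eqVneq => [? | _];
          [subst; rewrite ?eqxx; try by_contradiction |]);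
  try by_contradiction; rewrite /=; ring.

Ltac dual_coordinate :=
  split; [phi_case | move=> _ [i' j' k' lt'|i' k'|i' j' k' lt'|i' j' k' lt'];
    rewrite -!(zx, zy) => ?; phi_case].

Lemma elt_indep : lin_indep E.
Proof.
apply: lin_indep_dual => e Ee.
suff [a [b [c [e1 e0]]]] : exists a b c,
    phi a b c e = 1 /\ forall e', E e' -> e' != e -> phi a b c e' = 0.
  by exists (phi a b c); split=> //; apply: phi_lin.
case: Ee => [i j k lt|i k|i j k lt|i j k lt]; rewrite -!(zx, zy).
- exists (X i), (X j), (X k); dual_coordinate.
- exists (Y i), (X i), (X k); dual_coordinate.
- exists (X i), (X j), (Y k); dual_coordinate.
- exists (Y i), (X j), (X k); dual_coordinate.
Qed.

(** * The listed constants span *)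

Lemma lin_span_XXX i j k : lin_span E (w (X i) (X j) (X k)).
Proof.
case: (ltngtP j i) => [ji|ij|/val_inj ->].
- by apply: lin_span_mem; rewrite !(zx, zy); apply: Cxxx.
- rewrite pbr_pmulN; apply/lin_spanN/lin_span_mem.
  by rewrite !(zx, zy); apply: Cxxx.
- by rewrite pbrxx pmul0l; apply: lin_span0.
Qed.

Lemma lin_span_XXY_YXX i j k :
  lin_span E (w (X i) (X j) (Y k) + w (Y j) (X i) (X k)).
Proof.
case: (ltngtP j i) => [ji|ij|/val_inj ->].
- by apply: lin_span_mem; rewrite !(zx, zy); apply: Cxxy.
- (* The element of the third family for (j, i), subtracted from the element of
     the fourth family for (j, i). *)
  rewrite [w (X i) _ _]pbr_pmulN.
  have -> : - w (X j) (X i) (Y k) + w (Y j) (X i) (X k) =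
      (w (Y j) (X i) (X k) + w (Y i) (X j) (X k))
      - (w (X j) (X i) (Y k) + w (Y i) (X j) (X k)).
    by rewrite opprD addrACA subrr addr0 addrC.
  apply/lin_spanD/lin_spanN; apply: lin_span_mem.
    by rewrite !(zx, zy); apply: Cyxx.
  by rewrite !(zx, zy); apply: Cxxy.
- rewrite pbrxx pmul0l add0r.
  by apply: lin_span_mem; rewrite !(zx, zy); apply: Cyxx_diag.
Qed.

Lemma lin_span_YXX_YXX i j k :
  lin_span E (w (Y i) (X j) (X k) + w (Y j) (X i) (X k)).
Proof.
case: (ltngtP j i) => [ji|ij|/val_inj ->].
- by apply: lin_span_mem; rewrite !(zx, zy); apply: Cyxx.
- by rewrite addrC; apply: lin_span_mem; rewrite !(zx, zy); apply: Cyxx.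
- by apply: lin_spanD; apply: lin_span_mem; rewrite !(zx, zy); apply: Cyxx_diag.
Qed.

Lemma sum3_split (F : 'I_(n + n) -> 'I_(n + n) -> 'I_(n + n) -> P) :
  \sum_i \sum_j \sum_k F i j k =
  \sum_i \sum_j \sum_k
    ((F (X i) (X j) (X k) + F (X i) (X j) (Y k)
      + (F (X i) (Y j) (X k) + F (X i) (Y j) (Y k)))
     + (F (Y i) (X j) (X k) + F (Y i) (X j) (Y k)
      + (F (Y i) (Y j) (X k) + F (Y i) (Y j) (Y k)))).
Proof.
have split2 (G : 'I_(n + n) -> P) : \sum_a G a = \sum_i (G (X i) + G (Y i)).
  by rewrite big_split_ord /= -big_split.
rewrite split2; apply: eq_bigr => i _.
rewrite !split2 -big_split; apply: eq_bigr => j _ /=.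
by rewrite !split2 -!big_split.
Qed.

Lemma constant_span p :
  2%:R != 0 :> K -> B3_constants z delta p -> lin_span E p.
Proof.
move=> two_neq0 [pS dp0].
have kill a b c : (phi a b c \o delta) p = 0.
  by rewrite /= dp0 (scalar0 (phi_lin _ _ _)).
have yyy i j k : phi (Y i) (Y j) (Y k) p = 0.
  by rewrite -delta_YYX // kill.
have swap a b c : phi a b c p = - phi b a c p by apply: phi_antisym.
have yxy_sym i j k : phi (Y i) (X j) (Y k) p = phi (Y j) (X i) (Y k) p.
  have := delta_XXY pS i j k; rewrite kill [phi (X i) (Y j) _ _]swap.
  by move=> /esym/eqP; rewrite subr_eq0 => /eqP.
have yyxE i j k : phi (Y i) (Y j) (X k) p = - phi (Y i) (X j) (Y k) p.
  have := delta_YXX pS i j k; rewrite kill.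
  by move=> /esym/eqP; rewrite addr_eq0 => /eqP.
(* The coordinates yxy are symmetric in i and j by yxy_sym, and antisymmetric
   by yyxE because the coordinates yyx are. *)
have yxy i j k : phi (Y i) (X j) (Y k) p = 0.
  have a_ij : phi (Y i) (X j) (Y k) p = - phi (Y i) (X j) (Y k) p.
    by rewrite -[RHS]yyxE [RHS]swap yyxE opprK; apply: yxy_sym.
  by apply: (mulfI two_neq0); rewrite mulr0 mulr_natl mulr2n {1}a_ij addNr.
have yyx i j k : phi (Y i) (Y j) (X k) p = 0 by rewrite yyxE yxy oppr0.
have xyy i j k : phi (X i) (Y j) (Y k) p = 0 by rewrite swap yxy oppr0.
have xxyE i j k : phi (X i) (X j) (Y k) p =
    phi (Y j) (X i) (X k) p - phi (Y i) (X j) (X k) p.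
  have := delta_XXX pS i j k; rewrite kill [phi (X i) (Y j) _ _]swap => e0.
  apply/eqP; rewrite -subr_eq0; apply/eqP; rewrite e0; ring.
have p2 : lin_span E (p *+ 2).
  rewrite (coordinate_expansion pS) sum3_split.
  do 3! [apply: lin_span_sum => ?]; rewrite xyy yxy yyx yyy !scale0r !addr0.
  rewrite [phi (X _) (Y _) _ _]swap [w (X _) (Y _) _]pbr_pmulN.
  rewrite scaleNr scalerN opprK.
  set i := (X in phi (lshift n X) _ _); set j := (X in phi _ (lshift n X) _).
  set k := (X in phi _ _ (lshift n X)).
  (* By xxyE, the terms with [y_j,x_i].x_k added on the right amount to
     phi (Y j) (X i) (X k) p, which is the third term on the left. *)
  have -> : phi (X i) (X j) (X k) p *: w (X i) (X j) (X k)
      + phi (X i) (X j) (Y k) p *: w (X i) (X j) (Y k)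
      + phi (Y j) (X i) (X k) p *: w (Y j) (X i) (X k)
      + phi (Y i) (X j) (X k) p *: w (Y i) (X j) (X k) =
      phi (X i) (X j) (X k) p *: w (X i) (X j) (X k)
      + phi (X i) (X j) (Y k) p *:
          (w (X i) (X j) (Y k) + w (Y j) (X i) (X k))
      + phi (Y i) (X j) (X k) p *:
          (w (Y i) (X j) (X k) + w (Y j) (X i) (X k)).
    rewrite !scalerDr -!addrA; do 2! congr (_ + _).
    by rewrite xxyE scalerBl addrACA addNr addr0.
  apply: lin_spanD; first apply: lin_spanD; apply: lin_spanZ.
  - exact: lin_span_XXX.
  - exact: lin_span_XXY_YXX.
  - exact: lin_span_YXX_YXX.
rewrite -[p]scale1r -(mulVf two_neq0) -scalerA scaler_nat.
exact: lin_spanZ.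
Qed.

End Coordinates.
End Constants.

Theorem theorem7p2 (K : fieldType) (K_char0 : [pchar K]%R =i pred0) (n : nat)
  (P : poissonAlgType K) (x y : 'I_n -> P) (z : 'I_(n + n) -> P)
  (zx : forall i, z (lshift n i) = x i) (zy : forall i, z (rshift n i) = y i)
  (P_free : free_metabelian z)
  (delta : P -> P) (delta_der : poisson_derivation delta)
  (delta_y : forall i, delta (y i) = x i)
  (delta_x : forall i, delta (x i) = 0%R) :
  is_basis (B3_constants z delta) (B3_constants_elt x y).
Proof.
have [phi phiP] := coordinates_exist zx zy P_free delta_der delta_y delta_x.
have two_neq0 : 2%:R != 0 :> K by rewrite ((pcharf0P K).1 K_char0).
split.
- exact: (elt_constant zx zy delta_der delta_y delta_x).
- exact: (elt_indep zx zy phiP).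
- by move=> p; apply: (constant_span zx zy delta_der phiP).
Qed.
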